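(* Let $A\in\mathbb{R}^{n\times n}$ be symmetric with spectral interval contained in $[0,2c]$, $c>0$. Let $g\in\mathbb{R}^n$ with $\|g\|=1$, let $t\ge0$, let $y_k(t)=V_k\,t\,\varphi(-tH_k)e_1$ be the Krylov subspace approximation, obtained after $k$ Arnoldi steps, to $y(t)=t\varphi(-tA)g$, and let $r_k(t)=-Ay_k(t)+g-y_k'(t)$ be its residual. If $$k\ge\max\{5ct,2\},$$ then $$\|r_k(t)\|\le\frac{16\,(ct)^k}{(2k-1)!!}.$$
   Context: $\|\cdot\|$ is the vector/matrix 2-norm; $(2k-1)!!=1\cdot3\cdot5\cdots(2k-1)$. $\varphi$ is the entire function $\varphi(z)=(e^z-1)/z$ for $z\ne0$, $\varphi(0)=1$, applied to matrices as a matrix function. Arnoldi process: $k$ steps of the Arnoldi process for $A$ started with $v_1=g/\|g\|$ (assumed not to break down before step $k$; for symmetric $A$ this is the Lanczos process) produce a matrix $V_{k+1}=[v_1,\dots,v_k,v_{k+1}]\in\mathbb{R}^{n\times(k+1)}$ with orthonormal columns and an upper Hessenberg matrix $\underline{H}_k\in\mathbb{R}^{(k+1)\times k}$ such that $$AV_k=V_{k+1}\underline{H}_k=V_kH_k+h_{k+1,k}v_{k+1}e_k^T,$$ where $V_k=[v_1,\dots,v_k]$, its columns span $\mathrm{span}(g,Ag,\dots,A^{k-1}g)$, $H_k=V_k^TAV_k$ consists of the first $k$ rows of $\underline{H}_k$, $h_{k+1,k}\ge 0$ is the $(k+1,k)$ entry of $\underline{H}_k$, and $e_1,e_k$ are the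 first and last standard basis vectors of $\mathbb{R}^k$ (if $h_{k+1,k}=0$ the last term is zero). *)

(* Defs.v *)
From mathcomp Require Import all_boot all_order all_algebra.
From mathcomp Require Import all_classical all_reals all_analysis.

Set Implicit Arguments.
Unset Strict Implicit.
Unset Printing Implicit Defensive.

Import Order.TTheory GRing.Theory Num.Theory numFieldNormedType.Exports.
Local Open Scope classical_set_scope.
Local Open Scope ring_scope.

(* The norm `|x| that the library puts on matrices is the maximum norm. *)
Definition norm2 (R : realType) (n : nat) (x : 'cV[R]_n) : R :=
  Num.sqrt (\sum_(i < n) x i 0 ^+ 2).

(* (2k-1)!! *)
Definition odd_dfact (k : nat) : nat := (\prod_(1 <= j < k.+1) (2 * j - 1))%N.

Definition phi (R : realType) (z : R) : R :=
  if z == 0 then 1 else (expR z - 1) / z.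

(* f(B) for an entire function f that is real on the real line, as the sum of
   the Taylor series of f at 0; the Taylor coefficients can be computed from
   the restriction of f to R. *)
Definition matfun (R : realType) (f : R -> R) (m : nat) (B : 'M[R]_m) : 'M[R]_m :=
  limn (fun N : nat => \sum_(j < N) (derive1n j f 0 / j`!%:R) *: B ^+ j).

(* First standard basis vector, stated for arbitrary k to avoid casts. *)
Definition e_first (R : realType) (k : nat) : 'cV[R]_k :=
  \col_(i < k) (val i == 0%N)%:R.

Definition krylov_mx (R : realType) (n : nat) (A : 'M[R]_n) (g : 'cV[R]_n)
    (k : nat) : 'M[R]_(n, k) :=
  \matrix_(i < n, j < k) (A ^+ j *m g) i 0.

(* V is V_{k+1} and H the (k+1) x k Hessenberg matrix; V_k = lsubmx V and
   H_k = usubmx H. Positivity of h_{j+1,j} for j < k is the absence of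
   breakdown before step k. If h_{k+1,k} = 0 there need not be a further
   orthonormal vector (e.g. when k = n), so the last column of V is then left
   unconstrained. The last two fields follow from the others. *)
Record arnoldi (R : realType) (n : nat) (A : 'M[R]_n) (g : 'cV[R]_n) (k : nat)
    (V : 'M[R]_(n, k + 1)) (H : 'M[R]_(k + 1, k)) : Prop := Arnoldi {
  arnoldi_start : lsubmx V *m e_first R k = (norm2 g)^-1 *: g;
  arnoldi_orthonormal : (lsubmx V)^T *m lsubmx V = 1%:M;
  arnoldi_orthonormal_next :
    forall (i : 'I_(k + 1)) (j : 'I_k), val i = j.+1 -> val i = k ->
      H i j != 0 -> V^T *m V = 1%:M;
  arnoldi_hessenberg :
    forall (i : 'I_(k + 1)) (j : 'I_k), (j.+1 < i)%N -> H i j = 0;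
  arnoldi_no_breakdown :
    forall (i : 'I_(k + 1)) (j : 'I_k), val i = j.+1 -> (i < k)%N -> 0 < H i j;
  arnoldi_last_ge0 :
    forall (i : 'I_(k + 1)) (j : 'I_k), val i = j.+1 -> val i = k -> 0 <= H i j;
  arnoldi_relation : A *m lsubmx V = V *m H;
  arnoldi_span : ((lsubmx V)^T :=: (krylov_mx A g k)^T)%MS;
  arnoldi_projection : usubmx H = (lsubmx V)^T *m A *m lsubmx V
}.

(* y_k(t) = V_k t phi(-t H_k) e_1 *)
Definition krylov_approx (R : realType) (n k : nat) (V : 'M[R]_(n, k + 1))
    (H : 'M[R]_(k + 1, k)) (t : R) : 'cV[R]_n :=
  lsubmx V *m (t *: matfun (@phi R) (- t *: usubmx H)) *m e_first R k.

(* Residual of y for the initial value problem y' = - A y + g. *)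
Definition residual (R : realType) (n : nat) (A : 'M[R]_n) (g : 'cV[R]_n)
    (y : R -> 'cV[R]_n) (t : R) : 'cV[R]_n :=
  - A *m y t + g - derive1 y t.

(* Main.v *)
Require Import Defs.
From mathcomp Require Import all_boot all_order all_algebra.
From mathcomp Require Import all_classical all_reals all_analysis.
From mathcomp Require Import ring lra zify complex.

(** Write S = H_k, h = h_{k+1,k}, v = v_{k+1}, let pi be the product of the
    subdiagonal entries of S, and let U(t) = t phi(-tS), so that U(0) = 0 and
    U' = 1 - S U (flow_is_derive, flow_matfun).

    The Arnoldi relation A V_k = V_k S + h v e_k^T and the equation for U give
    r_k(t) = - h (e_k^T U(t) e_1) v (residual_krylov), so the norm of the
    residual is h |e_k^T U(t) e_1|, unless h = 0, in which case it vanishes.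
    Two bounds are multiplied.

    - |e_k^T U(t) e_1| <= |pi| t^k / k! (flow_last_entry_bound). Since S is
      Hessenberg, the entry is pi times a divided difference of
      x |-> (1 - e^(-tx)) / x at the k eigenvalues of S, which are nonnegative
      because S is a compression of A. No divided difference appears in the
      proof: the functions e_k^T p(S) U(t) e_1, where p runs through the partial
      products of the (X - a), a an eigenvalue of S, are linked by scalar
      equations F' + a F = G with a >= 0, and each of them costs one integration
      of a monomial in t (linear_ode_bound).

    - |h pi| <= 2 (c/2)^k (subdiag_prod_bound). The same Hessenberg structure
      shows that v^T q(A) v_1 = h pi for every monic q of degree k
      (krylov_horner), whence |h pi| <= max |q| over [0, 2c] by the spectral
      theorem (norm2_horner_le). The Chebyshev polynomial transported to
      [0, 2c] is the best q (monic_small_on_interval).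

    Together, the norm of the residual is at most
    2 (ct)^k / (2^k k!), and (2k-1)!! <= (2k)!! = 2^k k!. *)

Set Implicit Arguments.
Unset Strict Implicit.
Unset Printing Implicit Defensive.

Import Order.TTheory GRing.Theory Num.Theory numFieldNormedType.Exports.
Local Open Scope classical_set_scope.
Local Open Scope ring_scope.

(** * Power series with factorially decaying coefficients, and phi *)

Lemma is_cvg_pseries_fact (R : realType) (c : R^nat) (C M x : R) :
  (forall i, `|c i| <= C * M ^+ i / i`!%:R) -> cvgn (pseries c x).
Proof.
move=> cb.
have b0 i : 0 <= C * M ^+ i / i`!%:R by apply: le_trans (cb i); exact: normr_ge0.
apply: normed_cvg.
apply: (@series_le_cvg _ _ (fun i => C * exp_coeff (M * `|x|) i)) => [i|i|i|] /=.
- exact: normr_ge0.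
- by rewrite /exp_coeff /= exprMn !mulrA mulrAC mulr_ge0 ?exprn_ge0.
- rewrite /exp_coeff /= exprMn !mulrA mulrAC normrM normrX.
  by rewrite ler_wpM2r ?exprn_ge0.
- by apply: is_cvg_seriesZ; exact: is_cvg_series_exp_coeff.
Qed.

(** The class of coefficient sequences bounded by C M^i / i! is stable under
    differentiation; this is what makes the termwise derivatives below converge
    everywhere. *)
Lemma pseries_diffs_fact (R : realType) (c : R^nat) (C M : R) :
  (forall i, `|c i| <= C * M ^+ i / i`!%:R) ->
  forall i, `|pseries_diffs c i| <= (C * M) * M ^+ i / i`!%:R.
Proof.
move=> cb i; rewrite /pseries_diffs normrM normr_nat.
have := cb i.+1; rewrite -(ler_pM2l (x := i.+1%:R)) ?ltr0n // => /le_trans; apply.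
by rewrite factS natrM invfM exprS mulrCA mulVKf ?pnatr_eq0 // !mulrA.
Qed.

Lemma is_derive_pseries_fact (R : realType) (c : R^nat) (C M x : R) :
  (forall i, `|c i| <= C * M ^+ i / i`!%:R) ->
  is_derive x (1 : R) (fun x => limn (pseries c x))
    (limn (pseries (pseries_diffs c) x)).
Proof.
move=> cb; have db := pseries_diffs_fact cb; have ddb := pseries_diffs_fact db.
apply: (@pseries_snd_diffs _ c (`|x| + 1)).
- exact: is_cvg_pseries_fact cb.
- exact: is_cvg_pseries_fact db.
- exact: is_cvg_pseries_fact ddb.
- by rewrite [ltRHS]ger0_norm ?addr_ge0 // ltrDl.
Qed.

Lemma limn_pseries_at0 (R : realType) (c : R^nat) : limn (pseries c 0) = c 0%N.
Proof.
apply: cvg_lim => //; rewrite -cvg_shiftS /=.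
apply: cvg_near_cst; near=> n.
rewrite /pseries /series /= big_nat_recl //= expr0 mulr1 big1 ?addr0 //.
by move=> i _; rewrite expr0n /= mulr0.
Unshelve. all: by end_near. Qed.

Lemma phi_pseries (R : realType) (z : R) :
  phi z = limn (pseries (fun i => (i.+1`!%:R)^-1) z).
Proof.
rewrite /phi; case: eqVneq => [->|z0]; first by rewrite limn_pseries_at0 invr1.
have cv : cvgn (pseries (fun i => (i.+1`!%:R : R)^-1) z).
  apply: (@is_cvg_pseries_fact _ _ 1 1) => i; rewrite expr1n !mul1r.
  rewrite ger0_norm ?invr_ge0 // lef_pV2 ?posrE ?ltr0n ?fact_gt0 //.
  by rewrite ler_nat factS leq_pmull.
apply: (mulfI z0); rewrite mulrC divfK //; apply/eqP; rewrite subr_eq addrC.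
apply/eqP; rewrite /expR; apply: cvg_lim => //; rewrite -cvg_shiftS /=.
rewrite [X in X @ _](_ : _ =
    (fun n => 1 + z * pseries (fun i => (i.+1`!%:R : R)^-1) z n)); last first.
  apply/funext => n; rewrite /pseries /series /= big_nat_recl //=.
  rewrite /exp_coeff /= expr0 fact0 divr1; congr (_ + _).
  rewrite mulr_sumr; apply: eq_bigr => i _.
  by rewrite exprS -mulrA [z ^+ i / _]mulrC.
apply: cvgD; first exact: cvg_cst.
by apply: cvgM => //; exact: cvg_cst.
Qed.

(** The j-th derivative of phi is again an explicit everywhere convergent power
    series, so the induction carries that series along and evaluates it at 0
    only at the end. *)
Lemma derive1n_phi0 (R : realType) (j : nat) : derive1n j (@phi R) 0 = j.+1%:R^-1.
Proof.
have key : derive1n j (@phi R) =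
    (fun z => limn (pseries (fun i => ((i + j).+1%:R * i`!%:R)^-1) z)).
  elim: j => [|j IHj].
    apply/funext => z /=; rewrite phi_pseries; congr (limn (pseries _ z)).
    by apply/funext => i; rewrite addn0 factS natrM.
  apply/funext => z; rewrite derive1nS IHj derive1E.
  have b i : `|((i + j).+1%:R * i`!%:R)^-1| <= 1 * 1 ^+ i / i`!%:R :> R.
    rewrite expr1n !mul1r invfM normrM [X in _ * X]ger0_norm ?invr_ge0 //.
    rewrite ler_piMl ?invr_ge0 // ger0_norm ?invr_ge0 // invf_le1 ?ltr0n //.
    by rewrite ler1n.
  have [_ ->] := is_derive_pseries_fact z b.
  congr (limn (pseries _ z)); apply/funext => i; rewrite /pseries_diffs.
  rewrite factS natrM addSnnS !invfM mulrCA [_ * (_ * _^-1)]mulrA.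
  by rewrite mulfV ?mul1r // pnatr_eq0.
by rewrite key limn_pseries_at0 fact0 mulr1 add0n.
Qed.

(** * The matrix function t phi(-tS) *)

Lemma cvg_mx_entries (R : realType) (m n : nat) (u : nat -> 'M[R]_(m, n))
  (L : 'M[R]_(m, n)) :
  (forall i j, (fun N => u N i j) @ \oo --> L i j) -> u @ \oo --> L.
Proof.
move=> uL; apply/cvgrPdist_le => /= e e0; near=> N.
rewrite /Num.Def.normr/= mx_normrE (bigmax_le _ (ltW e0))//= => ij _.
rewrite !mxE; move: ij; near: N; apply: filter_forall => ij.
exact: ((cvgrPdist_le _ _).1 (uL ij.1 ij.2)).
Unshelve. all: by end_near. Qed.

Lemma mxpow_entry_bound (R : realType) (m : nat) (S : 'M[R]_m) (l : nat) i j :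
  `|(S ^+ l) i j| <= (1 + \sum_p \sum_q `|S p q|) ^+ l.
Proof.
elim: l i j => [|l IHl] i j.
  by rewrite !expr0 mxE; case: (i == j); rewrite ?normr1 ?normr0.
rewrite !exprS mxE (le_trans (ler_norm_sum _ _ _)) //.
apply: (@le_trans _ _ (\sum_p `|S i p| * (1 + \sum_p \sum_q `|S p q|) ^+ l)).
  by apply: ler_sum => p _; rewrite normrM ler_wpM2l.
rewrite -mulr_suml ler_wpM2r //.
  by rewrite exprn_ge0 // addr_ge0 // sumr_ge0 // => p _; rewrite sumr_ge0.
rewrite [X in _ <= 1 + X](bigD1 i) //= addrCA lerDl addr_ge0 // sumr_ge0 // => p _.
by rewrite sumr_ge0.
Qed.

(** The coefficient of t^l in the (i, j) entry of
    t phi(-tS) = sum_l t^(l+1) (-S)^l / (l+1)!. *)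
Definition flow_coef (R : realType) (m : nat) (S : 'M[R]_m) i j (l : nat) : R :=
  if l is l'.+1 then ((- S) ^+ l') i j / l`!%:R else 0.

(** This is t phi(-tS), defined entrywise as a power series in t so that it can
    be differentiated with scalar tools; flow_matfun gives the identification.
    It is the solution operator of u' = - S u + b, u(0) = 0, for constant b. *)
Definition flow (R : realType) (m : nat) (S : 'M[R]_m) (t : R) : 'M[R]_m :=
  \matrix_(i, j) limn (pseries (flow_coef S i j) t).

Lemma flow_coef_bound (R : realType) (m : nat) (S : 'M[R]_m) i j l :
  `|flow_coef S i j l| <=
    1 * (1 + \sum_p \sum_q `|(- S) p q|) ^+ l / l`!%:R.
Proof.
have M1 : 1 <= 1 + \sum_p \sum_q `|(- S) p q|.
  by rewrite lerDl sumr_ge0 // => p _; rewrite sumr_ge0.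
rewrite mul1r; case: l => [|l] /=.
  by rewrite normr0 divr_ge0 // exprn_ge0 // (le_trans ler01).
rewrite normrM [X in _ * X]ger0_norm ?invr_ge0 // ler_wpM2r ?invr_ge0 //.
by rewrite (le_trans (mxpow_entry_bound _ _ _ _)) // ler_weXn2l.
Qed.

Lemma flow0 (R : realType) (m : nat) (S : 'M[R]_m) : flow S 0 = 0.
Proof. by apply/matrixP => i j; rewrite !mxE limn_pseries_at0. Qed.

(** The derivative of the series has coefficients (-S)^l / l!; all of them but
    the first contain a factor -S, and what remains after extracting it is the
    series itself. *)
Lemma flow_is_derive (R : realType) (m : nat) (S : 'M[R]_m) (t : R) i j :
  is_derive t (1 : R) (fun s => flow S s i j) ((1%:M - S *m flow S t) i j).
Proof.
have -> : (fun s => flow S s i j) =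
    (fun s => limn (pseries (flow_coef S i j) s)).
  by apply/funext => s; rewrite mxE.
have D := is_derive_pseries_fact t (flow_coef_bound S i j).
suff <- : limn (pseries (pseries_diffs (flow_coef S i j)) t) =
    (1%:M - S *m flow S t) i j by [].
(* The shift isolates the constant term, which is the identity matrix. *)
apply: cvg_lim => //; rewrite -cvg_shiftS /=.
rewrite [X in X @ _](_ : _ = (fun n => (i == j)%:R +
    \sum_p (- S) i p * pseries (flow_coef S p j) t n.+1)); last first.
  apply/funext => n; rewrite /pseries /series /=.
  rewrite (eq_bigr (fun p => \sum_(0 <= l < n)
     (- S) i p * (flow_coef S p j l.+1 * t ^+ l.+1))); last first.
    by move=> p _; rewrite big_nat_recl //= mul0r add0r mulr_sumr.
  rewrite exchange_big /= big_nat_recl //; congr (_ + _).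
    by rewrite /pseries_diffs /= expr0 mul1r divr1 expr0 mulr1 mxE.
  apply: eq_bigr => l _; rewrite /pseries_diffs /= factS natrM invfM.
  rewrite [X in X * _]mulrCA mulVKf ?pnatr_eq0 // exprS mxE !mulr_suml.
  by apply: eq_bigr => p _; rewrite !mulrA.
have -> : (1%:M - S *m flow S t) i j =
    (i == j)%:R + \sum_p (- S) i p * flow S t p j.
  rewrite !mxE; congr (_ + _); rewrite -sumrN; apply: eq_bigr => p _.
  by rewrite !mxE mulNr.
apply: cvgD; first exact: cvg_cst.
apply: (@cvg_big R^o _ _ 0 xpredT (@add_continuous R^o)) => p _.
apply: cvgM; first exact: cvg_cst.
rewrite mxE cvg_shiftS; exact: is_cvg_pseries_fact (flow_coef_bound S p j).
Qed.

Lemma exprmxZ (R : comPzRingType) (m : nat) (a : R) (S : 'M[R]_m) (l : nat) :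
  (a *: S) ^+ l = a ^+ l *: S ^+ l.
Proof.
elim: l => [|l IHl]; first by rewrite !expr0 scale1r.
by rewrite !exprS IHl -!mulmxE -scalemxAl -scalemxAr scalerA.
Qed.

Lemma flow_matfun (R : realType) (m : nat) (S : 'M[R]_m) (t : R) :
  t *: matfun (@phi R) (- t *: S) = flow S t.
Proof.
pose b i j l := ((- S) ^+ l) i j / l.+1`!%:R : R.
pose L := \matrix_(i, j) limn (pseries (b i j) t).
have cvb i j : cvgn (pseries (b i j) t).
  apply: (@is_cvg_pseries_fact _ _ 1 (1 + \sum_p \sum_q `|(- S) p q|)) => l.
  rewrite normrM mul1r ler_pM ?mxpow_entry_bound //.
  rewrite ger0_norm ?invr_ge0 // lef_pV2 ?posrE ?ltr0n ?fact_gt0 //.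
  by rewrite ler_nat factS leq_pmull.
have -> : matfun (@phi R) (- t *: S) = L.
  apply: (cvg_lim (@norm_hausdorff _ _)); apply: cvg_mx_entries => i j.
  rewrite mxE [X in X @ _](_ : _ = pseries (b i j) t); first exact: cvb.
  apply/funext => n; rewrite summxE /pseries /series /= big_mkord.
  apply: eq_bigr => l _; rewrite derive1n_phi0 scaleNr -scalerN exprmxZ !mxE.
  by rewrite /b factS natrM invfM; ring.
apply/matrixP => i j; rewrite !mxE; apply/esym; apply: cvg_lim => //.
rewrite -cvg_shiftS /= [X in X @ _](_ : _ = (fun n => t * pseries (b i j) t n)).
  by apply: cvgM; [exact: cvg_cst|exact: cvb].
apply/funext => n; rewrite /pseries /series /= big_nat_recl //= mul0r add0r.
by rewrite mulr_sumr; apply: eq_bigr => l _; rewrite exprS mulrCA.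
Qed.

Lemma flow_is_derive_bilin (R : realType) (m p q : nat) (S : 'M[R]_m)
  (X : 'M[R]_(p, m)) (Y : 'M[R]_(m, q)) (t : R) i j :
  is_derive t (1 : R) (fun s => (X *m flow S s *m Y) i j)
    ((X *m (1%:M - S *m flow S t) *m Y) i j).
Proof.
pose D := 1%:M - S *m flow S t.
have -> : (fun s => (X *m flow S s *m Y) i j) =
    \sum_(l < m) \sum_(r < m) (X i r * Y l j) \*: (fun s => flow S s r l).
  apply/funext => s; rewrite fct_sumE mxE; apply: eq_bigr => l _.
  rewrite fct_sumE mxE mulr_suml; apply: eq_bigr => r _.
  by rewrite -[RHS]/(_ * _) mulrAC.
have -> : (X *m D *m Y) i j = \sum_(l < m) \sum_(r < m) (X i r * Y l j) *: D r l.
  rewrite mxE; apply: eq_bigr => l _; rewrite mxE mulr_suml.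
  by apply: eq_bigr => r _; rewrite -[RHS]/(_ * _) mulrAC.
apply: is_derive_sum => l; apply: is_derive_sum => r.
exact: is_deriveZ (flow_is_derive S t r l).
Qed.

(** * Comparison for scalar linear differential equations *)

(** Multiplying F by the integrating factor e^(lx) gives a function whose
    derivative e^(lx) G is nonnegative. *)
Lemma linear_ode_ge0 (R : realType) (F G : R -> R) (l t : R) :
  (forall x : R, is_derive x (1 : R) F (G x - l * F x)) -> F 0 = 0 ->
  0 <= t -> (forall x, 0 <= x -> 0 <= G x) -> 0 <= F t.
Proof.
move=> dF F0 t0 G0.
pose E := (fun x : R => expR (l * x)) * F.
have dE (x : R) : is_derive x (1 : R) E (expR (l * x) * G x).
  have dexp : is_derive x (1 : R) (fun x : R => expR (l * x)) (l * expR (l * x)).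
    have dlin : is_derive x (1 : R) (fun x => l * x) l.
      have := @is_deriveZ R R R id l x 1 1 (is_derive_id x (1 : R)).
      by rewrite -[l%:A]/(l * 1) mulr1.
    by have := is_derive1_comp (is_derive_expR (l * x)) dlin; rewrite mulrC.
  apply: (is_derive_eq (is_deriveM dexp (dF x))).
  by rewrite -![_ *: _]/(_ * _); ring.
have cE : {within `[0, t], continuous E}.
  apply: continuous_subspaceT => x; apply: differentiable_continuous.
  by apply/derivable1_diffP; have [] := dE x.
have [c ct] := MVT_segment t0 (fun x _ => dE x) cE.
rewrite [E 0](_ : _ = 0) ?subr0; last by rewrite /E fctE F0 mulr0.
move=> Et; rewrite -(pmulr_rge0 _ (expR_gt0 (l * t))).
rewrite -[_ * _]/(E t) Et mulr_ge0 // mulr_ge0 ?expR_ge0 // G0 //.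
by move: ct; rewrite in_itv /= => /andP[].
Qed.

(** For l >= 0 the damping term only helps: the right-hand side P of the bound
    satisfies P' + l P >= |G|, so P - F and P + F are solutions with nonnegative
    sources. *)
Lemma linear_ode_bound (R : realType) (F G : R -> R) (l C t : R) (m : nat) :
  (forall x : R, is_derive x (1 : R) F (G x - l * F x)) -> F 0 = 0 ->
  0 <= l -> 0 <= t ->
  (forall x, 0 <= x -> `|G x| <= C * x ^+ m / m`!%:R) ->
  `|F t| <= C * t ^+ m.+1 / m.+1`!%:R.
Proof.
move=> dF F0 l0 t0 Gb.
pose P (x : R) := C * x ^+ m.+1 / m.+1`!%:R.
have P0 : P 0 = 0 by rewrite /P expr0n /= mulr0 mul0r.
have C0 (x : R) : 0 <= x -> 0 <= C * x ^+ m / m`!%:R.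
  by move=> /Gb; apply: le_trans; exact: normr_ge0.
have Pge0 x : 0 <= x -> 0 <= P x.
  move=> x0; rewrite /P.
  have -> : C * x ^+ m.+1 / m.+1`!%:R = C * x ^+ m / m`!%:R * (x / m.+1%:R).
    by rewrite factS natrM exprS invfM; ring.
  by rewrite mulr_ge0 ?C0 // divr_ge0.
have dP (x : R) : is_derive x (1 : R) P (C * x ^+ m / m`!%:R).
  have dX := is_deriveX m.+1 (is_derive_id x (1 : R)); rewrite exprfctE in dX.
  have -> : P = (C / m.+1`!%:R) \*: (fun y : R => y ^+ m.+1).
    by apply/funext => y; rewrite /P mulrAC.
  apply: (is_derive_eq (is_deriveZ _ dX)).
  rewrite -![_ *: _]/(_ * _) mulr1 factS natrM /=.
  have m1 : m.+1%:R != 0 :> R by rewrite pnatr_eq0.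
  have mf : m`!%:R != 0 :> R by rewrite pnatr_eq0 -lt0n fact_gt0.
  move: m1 mf; move: (m.+1%:R) (m`!%:R) => u v u0 v0.
  by field; rewrite ?u0 ?v0.
suff key s : `|s| = 1 -> 0 <= P t + s * F t.
  rewrite ler_norml; have := key 1; have := key (-1).
  rewrite normrN normr1 => /(_ erefl) + /(_ erefl); rewrite -/(P t); lra.
move=> s1; pose G' x := C * x ^+ m / m`!%:R + s * G x + l * P x.
apply: (@linear_ode_ge0 _ (P + (fun x => s * F x)) G' l) => //.
- move=> x; apply: (is_derive_eq (is_deriveD (dP x) (is_deriveZ s (dF x)))).
  by rewrite /G' -[_ *: _]/(_ * _) fctE; ring.
- by rewrite fctE P0 F0 mulr0 addr0.
- move=> x x0; rewrite /G' addr_ge0 //; last by rewrite mulr_ge0 ?Pge0.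
  have := Gb x x0; rewrite -[X in X <= _]mul1r -s1 -normrM ler_norml.
  by move=> /andP[h _]; move: h; lra.
Qed.

(** * The Euclidean norm *)

Lemma norm2_sqr (R : realType) (n : nat) (x : 'cV[R]_n) :
  norm2 x ^+ 2 = (x^T *m x) 0 0.
Proof.
rewrite sqr_sqrtr ?sumr_ge0 // => [|i _]; last exact: sqr_ge0.
by rewrite mxE; apply: eq_bigr => i _; rewrite mxE expr2.
Qed.

Lemma norm2Z (R : realType) (n : nat) (a : R) (x : 'cV[R]_n) :
  norm2 (a *: x) = `|a| * norm2 x.
Proof.
rewrite /norm2 -sqrtr_sqr -sqrtrM ?sqr_ge0 // mulr_sumr; congr (Num.sqrt _).
by apply: eq_bigr => i _; rewrite mxE exprMn.
Qed.

Lemma norm2_eq0 (R : realType) (n : nat) (x : 'cV[R]_n) :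
  norm2 x == 0 -> x = 0.
Proof.
rewrite -sqrf_eq0 sqr_sqrtr ?sumr_ge0 // => [|i _]; last exact: sqr_ge0.
move=> /eqP/psumr_eq0P h; apply/colP => i; rewrite mxE; apply/eqP.
by rewrite -sqrf_eq0 h // => j _; exact: sqr_ge0.
Qed.

(** Cauchy-Schwarz for a unit vector x: the component of y orthogonal to x has
    squared norm |y|^2 - (x . y)^2. *)
Lemma unit_dot_le (R : realType) (n : nat) (x y : 'cV[R]_n) :
  (x^T *m x) 0 0 = 1 -> `|(x^T *m y) 0 0| <= norm2 y.
Proof.
move=> xx; rewrite -(@ler_pXn2r _ 2) ?nnegrE ?sqrtr_ge0 //.
rewrite real_normK ?num_real // norm2_sqr; set a := (x^T *m y) 0 0.
have : 0 <= norm2 (y - a *: x) ^+ 2 by rewrite sqr_ge0.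
have -> : norm2 (y - a *: x) ^+ 2 = (y^T *m y) 0 0 - a ^+ 2;
  last by rewrite subr_ge0.
have yx : (y^T *m x) 0 0 = a by rewrite -[y^T *m x]trmxK trmx_mul trmxK mxE.
have E : (y - a *: x)^T = y^T - a *: x^T by rewrite linearB linearZ.
rewrite norm2_sqr E mulmxBl !mulmxBr -!scalemxAl -!scalemxAr.
move: xx yx; rewrite /a.
move: (y^T *m y) (y^T *m x) (x^T *m y) (x^T *m x) => yy yx xy xx xx1 yxE.
by rewrite !mxE xx1 yxE; ring.
Qed.

(** * Functional calculus of real symmetric matrices *)

Section Spectral.

Local Open Scope sesquilinear_scope.
Local Open Scope complex_scope.

(** The unitary diagonalization is taken over the complex numbers, where a
    symmetric real matrix is Hermitian and hence has a real spectrum. A complex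
    eigenbasis is enough for everything below. *)
Lemma real_symmetric_spectral (R : realType) (n : nat) (S : 'M[R]_n) :
  S^T = S ->
  exists (P : 'M[R[i]]_n) (d : 'I_n -> R), P \is unitarymx /\
    map_mx (real_complex R) S = P^t* *m diag_mx (\row_i (d i)%:C) *m P.
Proof.
move=> symS; set C := map_mx _ S.
have Creal : C \is a realmx.
  by apply/mxOverP => i j; rewrite mxE; apply/complex_realP; exists (S i j).
have Csym : C \is symmetricmx.
  apply/is_hermitianmxP; rewrite expr0 scale1r map_mx_id //.
  by rewrite map_trmx symS.
have herm := realsym_hermsym Csym Creal.
have /mxOverP dreal := hermitian_spectral_diag_real herm.
exists (spectralmx C), (fun i => complex.Re (spectral_diag C 0 i)).
split; first exact: spectral_unitarymx.
rewrite -invmx_unitary ?spectral_unitarymx //.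
have /hermitian_normalmx/orthomx_spectralP {1}-> := herm.
congr (_ *m diag_mx _ *m _); apply/rowP => i.
by rewrite mxE RRe_real // dreal.
Qed.

(** The rows of P are complex eigenvectors; that d i is an eigenvalue over R too
    follows because both statements say that it is a root of the characteristic
    polynomial. *)
Lemma spectral_eigenvalue (R : realType) (n : nat) (S : 'M[R]_n)
  (P : 'M[R[i]]_n) (d : 'I_n -> R) :
  P \is unitarymx ->
  map_mx (real_complex R) S = P^t* *m diag_mx (\row_i (d i)%:C) *m P ->
  forall i, eigenvalue S (d i).
Proof.
move=> Pu PS i.
have : eigenvalue (map_mx (real_complex R) S) (d i)%:C.
  apply/eigenvalueP; exists (row i P).
    rewrite PS !mulmxA -row_mul (unitarymxP Pu) -row_mul mul1mx.
    by rewrite row_diag_mx mxE -scalemxAl -rowE.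
  apply/negP => /eqP Pi0.
  have := unitarymx_unit Pu; rewrite unitmxE => Pd.
  have : row i P *m P^t* = 0 by rewrite Pi0 mul0mx.
  rewrite -row_mul (unitarymxP Pu) => /rowP /(_ i).
  by rewrite !mxE eqxx => /eqP; rewrite oner_eq0.
by rewrite !eigenvalue_root_char -map_char_poly fmorph_root.
Qed.

Lemma horner_mx_spectral (R : realType) (n : nat) (S : 'M[R]_n.+1)
  (P : 'M[R[i]]_n.+1) (d : 'I_n.+1 -> R) (p : {poly R}) :
  P \is unitarymx ->
  map_mx (real_complex R) S = P^t* *m diag_mx (\row_i (d i)%:C) *m P ->
  map_mx (real_complex R) (horner_mx S p) =
    P^t* *m diag_mx (\row_i p.[d i]%:C) *m P.
Proof.
move=> Pu PS; have PP : P^t* *m P = 1%:M.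
  by rewrite -(invmx_unitary Pu) mulVmx // unitarymx_unit.
elim/poly_ind: p => [|p c IHp].
  rewrite rmorph0 map_mx0 (_ : \row_i _ = 0) ?linear0 ?mulmx0 ?mul0mx //.
  by apply/rowP => i; rewrite !mxE horner0.
rewrite rmorphD rmorphM /= horner_mx_X horner_mx_C map_mxD map_mxM.
rewrite map_scalar_mx /= IHp PS !mulmxA (mulmxtVK _ Pu).
rewrite (_ : (c%:C)%:M = P^t* *m (c%:C)%:M *m P); last first.
  by rewrite mul_mx_scalar -scalemxAl PP scalemx1.
rewrite -mulmxDl; congr (_ *m _).
rewrite -[X in X + _]mulmxA -mulmxDr; congr (_ *m _).
apply/matrixP => i j; rewrite mulmx_diag !mxE.
rewrite hornerMXaddC rmorphD rmorphM /= mulrnDl.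
by case: (i == j); rewrite ?mulr1n // !mulr0n.
Qed.

Lemma conj_real_mx (R : realType) (m n : nat) (X : 'M[R]_(m, n)) :
  (map_mx (real_complex R) X)^t* = map_mx (real_complex R) X^T.
Proof.
apply/matrixP => i j; rewrite !mxE; apply/CrealP; apply/complex_realP.
by exists (X j i).
Qed.

Lemma norm2_spectral (R : realType) (n : nat) (P : 'M[R[i]]_n) (x : 'cV[R]_n) :
  P \is unitarymx ->
  (norm2 x ^+ 2)%:C = \sum_i `|(P *m map_mx (real_complex R) x) i 0| ^+ 2.
Proof.
move=> Pu; set z := P *m _.
have <- : (z^t* *m z) 0 0 = \sum_i `|z i 0| ^+ 2.
  by rewrite mxE; apply: eq_bigr => i _; rewrite !mxE normCK mulrC.
rewrite /z trmx_mul map_mxM mulmxA -[_ *m _ *m P]mulmxA.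
rewrite -(invmx_unitary Pu) mulVmx ?unitarymx_unit // mulmx1.
by rewrite conj_real_mx -map_mxM mxE norm2_sqr.
Qed.

(** In the eigenbasis p(S) multiplies the i-th coordinate by p(d i). *)
Lemma norm2_horner_le (R : realType) (n : nat) (S : 'M[R]_n.+1)
  (p : {poly R}) (M : R) (x : 'cV[R]_n.+1) :
  S^T = S -> 0 <= M -> (forall a, eigenvalue S a -> `|p.[a]| <= M) ->
  norm2 (horner_mx S p *m x) <= M * norm2 x.
Proof.
move=> symS M0 pM; have [P [d [Pu PS]]] := real_symmetric_spectral symS.
rewrite -ler_sqr ?nnegrE ?mulr_ge0 ?sqrtr_ge0 // exprMn.
suff : (norm2 (horner_mx S p *m x) ^+ 2)%:C <= (M ^+ 2)%:C * (norm2 x ^+ 2)%:C.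
  by rewrite -rmorphM lecR.
rewrite !(norm2_spectral _ Pu) mulr_sumr.
apply: ler_sum => i _; rewrite map_mxM /= (horner_mx_spectral _ Pu PS) !mulmxA.
rewrite (unitarymxP Pu) mul1mx -mulmxA mul_diag_mx 2!mxE normrM exprMn.
rewrite ler_wpM2r ?exprn_ge0 //.
rewrite normc_def /= expr0n addr0 sqrtr_sqr -rmorphXn /= lecR.
by rewrite lerXn2r ?nnegrE // pM //; exact: spectral_eigenvalue Pu PS i.
Qed.

(** The list has one entry per dimension: the number of factors is what will
    become the exponent k of t^k / k!, so eigenvalues are repeated according to
    multiplicity. *)
Lemma symmetric_annihilated (R : realType) (n : nat) (S : 'M[R]_n.+1) :
  S^T = S -> exists s : seq R, [/\ size s = n.+1,
    {in s, forall a, eigenvalue S a} &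
    horner_mx S (\prod_(a <- s) ('X - a%:P)) = 0].
Proof.
move=> symS; have [P [d [Pu PS]]] := real_symmetric_spectral symS.
exists [seq d i | i <- enum 'I_n.+1]; split.
- by rewrite size_map size_enum_ord.
- by move=> _ /mapP[i _ ->]; exact: spectral_eigenvalue Pu PS i.
- apply/(map_mx_inj (f := real_complex R)).
  rewrite (horner_mx_spectral _ Pu PS) (_ : \row_i _ = 0).
    by rewrite map_mx0 linear0 mulmx0 mul0mx.
  apply/rowP => i; rewrite !mxE (_ : _.[d i] = 0) //; apply/rootP.
  by rewrite root_prod_XsubC map_f ?mem_enum.
Qed.

Lemma quadratic_form_ge0 (R : realType) (n : nat) (S : 'M[R]_n)
  (x : 'cV[R]_n) :
  S^T = S -> (forall a, eigenvalue S a -> 0 <= a) ->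
  0 <= (x^T *m S *m x) 0 0.
Proof.
move=> symS S0; have [P [d [Pu PS]]] := real_symmetric_spectral symS.
suff : (0 : R[i]) <= ((x^T *m S *m x) 0 0)%:C by rewrite lecR.
set z := P *m map_mx (real_complex R) x.
have -> : ((x^T *m S *m x) 0 0)%:C = (z^t* *m diag_mx (\row_i (d i)%:C) *m z) 0 0.
  rewrite /z trmx_mul map_mxM /= conj_real_mx !mulmxA.
  rewrite -[_ *m _ *m P]mulmxA -[_ *m (_ *m P)]mulmxA [P^t* *m _]mulmxA -PS.
  by rewrite -!map_mxM [RHS]mxE.
rewrite mul_mx_diag mxE sumr_ge0 // => i _; rewrite !mxE.
rewrite mulrAC mulrC mulr_ge0 ?lecR ?S0 //;
  first exact: spectral_eigenvalue Pu PS i.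
by rewrite mulrC -normCK exprn_ge0.
Qed.

End Spectral.

(** * Hessenberg matrices and Krylov vectors *)

Definition subdiag_prod (R : comNzRingType) (k : nat)
  (S : 'M[R]_k.+1) (m : nat) : R :=
  \prod_(j < m) S (inord j.+1) (inord j).

(** A Hessenberg matrix moves e_j into the span of e_1, ..., e_(j+1), so S^m e_1
    has no component beyond index m (counted from 0), and the component at index
    m picks up one subdiagonal entry per step. *)
Lemma hessenberg_pow (R : realType) (k : nat) (S : 'M[R]_k.+1) (m : nat)
  (i : 'I_k.+1) :
  (forall i j : 'I_k.+1, (j.+1 < i)%N -> S i j = 0) -> (m <= i)%N ->
  (S ^+ m *m e_first R k.+1) i 0 = (m == i)%:R * subdiag_prod S i.
Proof.
move=> hess; elim: m i => [|m IHm] i mi.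
  rewrite expr0 mul1mx mxE eq_sym /=; case: eqP => [<-|_]; last by rewrite mul0r.
  by rewrite /subdiag_prod big_ord0 mulr1.
have mk : (m < k.+1)%N by apply: leq_trans mi _; rewrite ltnW.
rewrite exprS -mulmxE -mulmxA mxE (bigD1 (Ordinal mk)) //= big1 ?addr0 => [|p pm].
  rewrite IHm //= eqxx mul1r eq_sym.
  case: (ltngtP i m.+1) mi => // [mi|im] _.
    by rewrite hess ?mul0r.
  rewrite mul1r im /subdiag_prod big_ord_recr /= mulrC.
  by congr (_ * S _ _); apply/val_inj; rewrite /= inordK // -im.
(* For p != m, either p + 1 < i and S i p vanishes, or m < p and the p-th
   coordinate of S^m e_1 does. *)
have [pi|ip] := ltnP p.+1 i; first by rewrite hess ?mul0r.
have mp : (m == p) = false.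
  by apply: contraNF pm => /eqP mp; apply/eqP/val_inj.
by rewrite IHm ?mp ?mul0r ?mulr0 // -ltnS (leq_trans mi).
Qed.

Lemma horner_mx_sum (R : comNzRingType) (n : nat) (S : 'M[R]_n.+1)
  (q : {poly R}) (m : nat) : (size q <= m)%N ->
  horner_mx S q = \sum_(l < m) q`_l *: S ^+ l.
Proof.
move=> sq; have {1}-> : q = \poly_(l < m) q`_l.
  apply/polyP => l; rewrite coef_poly; case: ltnP => // ml.
  by rewrite nth_default // (leq_trans sq).
rewrite poly_def rmorph_sum /=; apply: eq_bigr => l _.
by rewrite horner_mxZ rmorphXn /= horner_mx_X.
Qed.

Lemma hessenberg_horner (R : realType) (k : nat) (S : 'M[R]_k.+1)
  (q : {poly R}) (i : 'I_k.+1) :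
  (forall i j : 'I_k.+1, (j.+1 < i)%N -> S i j = 0) -> (size q <= i.+1)%N ->
  (horner_mx S q *m e_first R k.+1) i 0 = q`_i * subdiag_prod S i.
Proof.
move=> hess sq; rewrite (horner_mx_sum _ sq) mulmx_suml summxE.
rewrite big_ord_recr /= big1 ?add0r => [|l _].
  by rewrite -scalemxAl mxE hessenberg_pow // eqxx mul1r.
rewrite -scalemxAl mxE hessenberg_pow // ?ltn_eqF ?mul0r ?mulr0 //.
exact: ltnW.
Qed.

(** Up to degree k the Krylov vectors A^m v_1 are W S^m e_1 and stay in the span
    of W, which v is orthogonal to; only degree k+1 leaves it, along v, with
    coefficient h times the last entry of S^k e_1. Hence v only sees the top
    coefficient of q. *)
Lemma krylov_horner (R : realType) (n k : nat) (A : 'M[R]_n.+1)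
  (W : 'M[R]_(n.+1, k.+1)) (v : 'cV[R]_n.+1) (S : 'M[R]_k.+1) (h : R)
  (q : {poly R}) :
  (forall i j : 'I_k.+1, (j.+1 < i)%N -> S i j = 0) ->
  A *m W = W *m S + h *: (v *m delta_mx 0 ord_max) ->
  v^T *m W = 0 -> v^T *m v = 1%:M -> (size q <= k.+2)%N ->
  (v^T *m (horner_mx A q *m (W *m e_first R k.+1))) 0 0 =
    q`_k.+1 * (h * subdiag_prod S k).
Proof.
move=> hess AW vW vv sq.
(* The rank-one term of A W contributes nothing as long as the last coordinate
   of S^m e_1 is zero. *)
have pw m : (m <= k)%N ->
    A ^+ m *m (W *m e_first R k.+1) = W *m (S ^+ m *m e_first R k.+1).
  elim: m => [|m IHm] mk; first by rewrite !expr0 !mul1mx.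
  rewrite !exprS -!mulmxE -!mulmxA IHm 1?ltnW // mulmxA AW mulmxDl.
  rewrite -[W *m S *m _]mulmxA -[RHS]addr0; congr (_ + _).
  rewrite -scalemxAl -mulmxA -rowE (_ : row _ _ = 0) ?mulmx0 ?scaler0 //.
  apply/rowP => j; rewrite !ord1 [LHS]mxE hessenberg_pow //=; last exact: ltnW.
  by rewrite ltn_eqF // mul0r mxE.
have p0 m : (m <= k)%N -> v^T *m (A ^+ m *m (W *m e_first R k.+1)) = 0.
  by move=> mk; rewrite pw // mulmxA vW mul0mx.
rewrite (horner_mx_sum _ sq) mulmx_suml mulmx_sumr summxE.
rewrite big_ord_recr /= big1 ?add0r => [|l _].
  rewrite -scalemxAl -scalemxAr mxE; congr (_ * _).
  rewrite exprS -mulmxE -!mulmxA pw // [A *m _]mulmxA AW mulmxDl mulmxDr.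
  rewrite -[W *m S *m _]mulmxA [v^T *m (W *m _)]mulmxA vW mul0mx add0r.
  rewrite -scalemxAl -scalemxAr -mulmxA [v^T *m _]mulmxA vv mul1mx mxE.
  by rewrite -rowE mxE hessenberg_pow //= eqxx mul1r.
by rewrite -scalemxAl -scalemxAr p0 ?scaler0 ?mxE // -ltnS.
Qed.

(** * Chebyshev polynomials *)

(** T and U are the Chebyshev polynomials of the first kind of degree n+1 and of
    the second kind of degree n. The last identity is cos^2 + sin^2 = 1; it
    yields |T| <= 1 on [-1, 1] without trigonometry. The recursion in the proof
    is the addition formula for cos and sin, divided by sin for U. *)
Lemma chebyshev_exists (R : realDomainType) (n : nat) :
  exists T U : {poly R},
  [/\ (size T <= n.+2)%N, (size U <= n.+1)%N, T`_n.+1 = 2 ^+ n, U`_n = 2 ^+ n &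
      forall s, T.[s] ^+ 2 + (1 - s ^+ 2) * U.[s] ^+ 2 = 1].
Proof.
elim: n => [|n [T [U [sT sU cT cU TU]]]].
  exists 'X, 1; split; rewrite ?size_polyX ?size_poly1 ?coefX ?coef1 //.
  by move=> s; rewrite hornerX -polyC1 hornerC; ring.
have small (p : {poly R}) m l : (size p <= m)%N -> (m <= l)%N -> p`_l = 0.
  by move=> pm ml; rewrite nth_default // (leq_trans pm).
have cT' j : ('X * T - (1 - 'X^2) * U)`_j.+2 = T`_j.+1 - U`_j.+2 + U`_j.
  rewrite coefB coefXM mulrBl coefB mul1r coefXnM /= subn2 /= opprB addrA.
  by rewrite addrAC.
have cU' j : ('X * U + T)`_j.+1 = U`_j + T`_j.+1 by rewrite coefD coefXM.
exists ('X * T - (1 - 'X^2) * U), ('X * U + T); split.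
- apply/leq_sizeP => -[|[|j]] // jn; rewrite cT' (small T n.+2) //.
  by rewrite (small U n.+1) ?(small U n.+1 j) ?subrr ?addr0 //; lia.
- apply/leq_sizeP => -[|j] // jn; rewrite cU' (small T n.+2) //.
  by rewrite (small U n.+1) ?addr0.
- by rewrite cT' cT cU (small U n.+1) // subr0 exprS mulr_natl mulr2n.
- by rewrite cU' cT cU exprS mulr_natl mulr2n.
- move=> s; rewrite -[RHS](TU s) -polyC1.
  by rewrite !(hornerD, hornerN, hornerM, hornerX, hornerXn, hornerC); ring.
Qed.

(** The Chebyshev polynomial of degree n+1, transported from [-1, 1] to [0, 2c]
    by x |-> (x - c) / c and made monic. *)
Lemma monic_small_on_interval (R : realFieldType) (n : nat) (c : R) :
  0 < c ->
  exists q : {poly R}, [/\ (size q <= n.+2)%N, q`_n.+1 = 1 &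
    forall a, 0 <= a <= 2 * c -> `|q.[a]| <= c ^+ n.+1 / 2 ^+ n].
Proof.
move=> c0; have [T [U [sT _ cT _ TU]]] := chebyshev_exists R n.
have T1 s : `|s| <= 1 -> `|T.[s]| <= 1.
  move=> s1; rewrite -(@ler_pXn2r _ 2) ?nnegrE // expr1n real_normK ?num_real //.
  rewrite -(TU s) lerDl mulr_ge0 ?sqr_ge0 // subr_ge0 -real_normK ?num_real //.
  by rewrite expr_le1.
pose l : {poly R} := c^-1 *: ('X - c%:P).
have ci0 : c^-1 != 0 by rewrite invr_eq0 gt_eqF.
have sizel : size l = 2%N by rewrite size_scale // size_XsubC.
have leadl : lead_coef l = c^-1.
  by rewrite lead_coefZ lead_coefXsubC mulr1.
have two0 : 2 ^+ n != 0 :> R by rewrite expf_neq0 // pnatr_eq0.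
have sT' : size T = n.+2.
  apply/eqP; rewrite eqn_leq sT /= ltnNge; apply/negP => /leq_sizeP/(_ n.+1).
  by rewrite leqnn => /(_ isT) /eqP; rewrite cT (negPf two0).
have sTl : size (T \Po l) = n.+2.
  have := size_comp_poly T l; rewrite sizel sT' muln1 /=.
  by case: (size _) => //= m ->.
exists ((c ^+ n.+1 / 2 ^+ n) *: (T \Po l)); split.
- by rewrite (leq_trans (size_scale_leq _ _)) // sTl.
- have := lead_coef_comp T (q := l); rewrite sizel => /(_ isT).
  rewrite /lead_coef sTl -/(lead_coef l) leadl sT' /= cT coefZ => ->.
  by rewrite mulrA divfK // -exprMn divff ?expr1n // gt_eqF.
- move=> a /andP[a0 ac]; have K0 : 0 <= c ^+ n.+1 / 2 ^+ n :> R.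
    by rewrite divr_ge0 // exprn_ge0 // ltW.
  rewrite hornerZ normrM ger0_norm // ler_piMr // horner_comp T1 //.
  rewrite hornerZ hornerXsubC normrM [`|c^-1|]ger0_norm ?invr_ge0 ?(ltW c0) //.
  by rewrite mulrC ler_pdivrMr // mul1r ler_norml; apply/andP; split; lra.
Qed.

(** * The two bounds *)

(** Let F q be the last entry of q(S) t phi(-tS) e_1. From the equation of the
    flow, (F p)' + a F p = b - F (p (X - a)), where b, the last entry of p(S) e_1,
    vanishes unless p has degree k. Induction on the list of the factors that
    p still lacks thus starts at F p = 0, where p annihilates S, meets the
    constant source b = pi at the first step, and gains one power of t at each
    step. *)
Lemma flow_last_entry_bound (R : realType) (k : nat) (S : 'M[R]_k.+1)
  (s : seq R) (p : {poly R}) (t : R) :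
  (forall i j : 'I_k.+1, (j.+1 < i)%N -> S i j = 0) ->
  p \is monic -> (size p + size s = k.+2)%N ->
  {in s, forall a, 0 <= a} ->
  horner_mx S (p * \prod_(a <- s) ('X - a%:P)) = 0 -> 0 <= t ->
  `|(horner_mx S p *m flow S t *m e_first R k.+1) ord_max 0| <=
    `|subdiag_prod S k| * t ^+ size s / (size s)`!%:R.
Proof.
move=> hess; elim: s p t => [|a s IHs] p t monp sz s0 ann t0.
  move: ann; rewrite big_nil mulr1 => ->.
  by rewrite !mul0mx mxE normr0 mulr_ge0 // expr0 mulr1.
pose F q x := (horner_mx S q *m flow S x *m e_first R k.+1) ord_max 0.
pose b := (horner_mx S p *m e_first R k.+1) ord_max 0.
apply: (@linear_ode_bound _ (F p) (fun x => b - F (p * ('X - a%:P)) x) a) => //.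
- move=> x; apply: (is_derive_eq (flow_is_derive_bilin S _ _ x _ _)).
  rewrite mulmxBr mulmx1 mulmxBl mxE [in X in _ + X]mxE -/b.
  rewrite /F mulrBr rmorphB /= rmorphM /= horner_mx_X rmorphM /= horner_mx_C.
  rewrite -!mulmxE mul_mx_scalar !mulmxBl -!scalemxAl !mulmxA !mxE.
  ring.
- by rewrite /F flow0 mulmx0 mul0mx mxE.
- by rewrite s0 ?mem_head.
move=> x x0.
have sp : (size p <= k.+1)%N by move: sz => /=; lia.
have bE : b = p`_k * subdiag_prod S k by rewrite /b hessenberg_horner.
have mon' : p * ('X - a%:P) \is monic by rewrite monicMl ?monicXsubC.
have ann' : horner_mx S (p * ('X - a%:P) * \prod_(j <- s) ('X - j%:P)) = 0.
  by rewrite -ann big_cons mulrA.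
case: s => [|a' s] in IHs sz s0 ann ann' *.
  rewrite big_nil mulr1 in ann'.
  rewrite /F ann' !mul0mx mxE subr0 expr0 mulr1 divr1 bE.
  move: sz => /= /eqP; rewrite addn1 eqSS => /eqP sz.
  by move/monicP: monp; rewrite /lead_coef sz /= => ->; rewrite mul1r.
rewrite bE nth_default ?mul0r ?sub0r ?normrN; last by move: sz => /=; lia.
apply: IHs => //; last by move=> y ys; rewrite s0 // inE ys orbT.
rewrite size_Mmonic ?monicXsubC ?monic_neq0 // size_XsubC.
by move: sz => /=; lia.
Qed.

(** The quantity h pi is v^T q(A) v_1 for every monic q of degree k+1, hence at
    most the size of q on the spectrum of A. *)
Lemma subdiag_prod_bound (R : realType) (n k : nat) (A : 'M[R]_n.+1)
  (W : 'M[R]_(n.+1, k.+1)) (v : 'cV[R]_n.+1) (S : 'M[R]_k.+1) (h c : R) :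
  A^T = A -> 0 < c -> (forall a, eigenvalue A a -> 0 <= a <= 2 * c) ->
  (forall i j : 'I_k.+1, (j.+1 < i)%N -> S i j = 0) ->
  A *m W = W *m S + h *: (v *m delta_mx 0 ord_max) ->
  v^T *m W = 0 -> v^T *m v = 1%:M -> norm2 (W *m e_first R k.+1) = 1 ->
  `|h * subdiag_prod S k| <= c ^+ k.+1 / 2 ^+ k.
Proof.
move=> symA c0 Ac hess AW vW vv w1.
have [q [sq q1 qb]] := monic_small_on_interval k c0.
have := krylov_horner hess AW vW vv sq; rewrite q1 mul1r => <-.
have v1 : (v^T *m v) 0 0 = 1 by rewrite vv mxE.
apply: le_trans (unit_dot_le _ v1) _.
have := @norm2_horner_le _ _ A q (c ^+ k.+1 / 2 ^+ k) (W *m e_first R k.+1) symA.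
rewrite w1 mulr1; apply=> [|a /Ac]; last exact: qb.
by rewrite divr_ge0 // exprn_ge0 // ltW.
Qed.

(** * The residual of the Krylov approximation *)

(** The approximation solves the projected equation exactly: V_k (u' + S u - e_1)
    cancels and only the part of A V_k u that leaves the Krylov space remains. *)
Lemma residual_krylov (R : realType) (n k : nat) (A : 'M[R]_n) (g : 'cV[R]_n)
  (V : 'M[R]_(n, k.+1 + 1)) (H : 'M[R]_(k.+1 + 1, k.+1)) (h t : R) :
  lsubmx V *m e_first R k.+1 = g ->
  A *m lsubmx V =
    lsubmx V *m usubmx H + h *: (rsubmx V *m delta_mx 0 ord_max) ->
  residual A g (krylov_approx V H) t =
    - (h * (flow (usubmx H) t *m e_first R k.+1) ord_max 0) *: rsubmx V.
Proof.
move=> Vg AV; set W := lsubmx V in Vg AV *; set S := usubmx H in AV *.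
have yE : krylov_approx V H = (fun s => W *m flow S s *m e_first R k.+1).
  by apply/funext => s; rewrite /krylov_approx flow_matfun.
rewrite /residual yE derive1E.
have D i j := flow_is_derive_bilin S W (e_first R k.+1) t i j.
rewrite derive_mx; last by apply/derivable_mxP => i j; have [] := D i j.
rewrite (_ : \matrix_(i, j) _ = W *m (1%:M - S *m flow S t) *m e_first R k.+1);
  last by apply/matrixP => i j; rewrite mxE; have [_ ->] := D i j.
set F := flow S t; set e := e_first R k.+1 in Vg *.
have lastE : delta_mx 0 ord_max *m (F *m e) = ((F *m e) ord_max 0)%:M.
  by rewrite -rowE; apply/matrixP => i j; rewrite !ord1 !mxE eqxx mulr1n.
have AE : A *m (W *m F *m e) =
    W *m (S *m F) *m e + (h * (F *m e) ord_max 0) *: rsubmx V.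
  rewrite -[W *m F *m e]mulmxA mulmxA AV mulmxDl; congr (_ + _);
    first by rewrite !mulmxA.
  by rewrite -scalemxAl -mulmxA lastE mul_mx_scalar scalerA.
rewrite mulNmx AE mulmxBr mulmx1 mulmxBl Vg scaleNr.
rewrite opprD opprB.
move: (W *m (S *m F) *m e) (_ *: rsubmx V) => X Y.
by apply/matrixP => i j; rewrite !mxE; ring.
Qed.

(** The right-hand side is (2k)!!. *)
Lemma odd_dfact_le (k : nat) : (odd_dfact k <= 2 ^ k * k`!)%N.
Proof.
rewrite /odd_dfact; elim: k => [|k IHk]; first by rewrite big_nil.
by rewrite big_nat_recr //= factS expnS; nia.
Qed.

Lemma odd_dfact_gt0 (k : nat) : (0 < odd_dfact k)%N.
Proof.
rewrite /odd_dfact; elim: k => [|k IHk]; first by rewrite big_nil.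
by rewrite big_nat_recr //= muln_gt0 IHk; lia.
Qed.

Theorem proposition4p5 (R : realType) (n : nat) (A : 'M[R]_n) (c : R)
    (g : 'cV[R]_n) (t : R) (k : nat)
    (V : 'M[R]_(n, k + 1)) (H : 'M[R]_(k + 1, k)) :
  A^T = A ->
  0 < c ->
  (forall a : R, eigenvalue A a -> 0 <= a <= 2 * c) ->
  norm2 g = 1 ->
  0 <= t ->
  arnoldi A g V H ->
  Num.max (5 * c * t) 2 <= k%:R ->
  norm2 (residual A g (krylov_approx V H) t)
    <= 16 * (c * t) ^+ k / (odd_dfact k)%:R.
Proof.
move=> symA c0 Ac g1 t0 ar; rewrite ge_max => /andP[_ k2].
have k0 : (0 < k)%N.
  by rewrite -(ltr0n R) (lt_le_trans _ k2).
case: k => [//|k] in V H ar k2 k0 *.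
case: n => [|n] in A g V symA Ac g1 ar *.
  by move: g1; rewrite /norm2 big_ord0 sqrtr0 => /eqP; rewrite eq_sym oner_eq0.
case: ar => start orth orthn hess _ _ rel _ proj.
rewrite g1 invr1 scale1r in start.
set W := lsubmx V in start orth rel proj; set S := usubmx H in proj.
pose v := rsubmx V; pose h := dsubmx H 0 ord_max.
have hessS (i j : 'I_k.+1) : (j.+1 < i)%N -> S i j = 0.
  by move=> ij; rewrite /S mxE hess.
(* The last row of the Hessenberg matrix is zero except for its last entry h. *)
have AW : A *m W = W *m S + h *: (v *m delta_mx 0 ord_max).
  rewrite rel -{1}[V]hsubmxK -{1}[H]vsubmxK mul_row_col -/W -/S; congr (_ + _).
  rewrite scalemxAr; congr (_ *m _); apply/matrixP => i j; rewrite !ord1 !mxE.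
  have [->|jk] := eqVneq j ord_max; first by rewrite mulr1 /h mxE.
  rewrite mulr0 hess //= addn0 ltnS ltn_neqAle -ltnS ltn_ord andbT.
  by apply: contra jk => /eqP jk; apply/eqP/val_inj.
rewrite (residual_krylov _ start AW) norm2Z.
have rhs0 : 0 <= 16 * (c * t) ^+ k.+1 / (odd_dfact k.+1)%:R :> R.
  by rewrite divr_ge0 // mulr_ge0 // exprn_ge0 // mulr_ge0 // ltW.
have [h0|h0] := eqVneq h 0; first by rewrite h0 mul0r oppr0 normr0 mul0r.
have VV : V^T *m V = 1%:M.
  apply: (orthn (rshift k.+1 0) ord_max); rewrite /= ?addn0 //.
  by move: h0; rewrite /h mxE.
have [vW vv] : v^T *m W = 0 /\ v^T *m v = 1%:M.
  move: VV; rewrite -[V]hsubmxK tr_row_mx mul_col_row (@scalar_mx_block _ k.+1 1).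
  by case/eq_block_mx.
have v1 : norm2 v = 1.
  by rewrite -[norm2 v]ger0_norm ?sqrtr_ge0 // -sqrtr_sqr norm2_sqr vv mxE sqrtr1.
rewrite v1 mulr1 normrN normrM.
have hpi : `|h * subdiag_prod S k| <= c ^+ k.+1 / 2 ^+ k.
  by apply: (subdiag_prod_bound symA c0 Ac hessS AW vW vv); rewrite start.
have symS : S^T = S by rewrite proj !trmx_mul trmxK symA mulmxA.
have [s [ss sS annS]] := symmetric_annihilated symS.
(* A row eigenvector u of S gives a u u^T = (W u^T)^T A (W u^T) >= 0. *)
have Spos a : eigenvalue S a -> 0 <= a.
  move=> /eigenvalueP[u uS u0].
  have := quadratic_form_ge0 (W *m u^T) symA.
  rewrite trmx_mul trmxK -!mulmxA [A *m _]mulmxA [W^T *m _]mulmxA.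
  rewrite [W^T *m _]mulmxA -proj [u *m _]mulmxA uS -scalemxAl mxE.
  have u2 : (u *m u^T) 0 0 = norm2 u^T ^+ 2 by rewrite norm2_sqr trmxK.
  move=> /(_ (fun b Ab => proj1 (andP (Ac b Ab)))); rewrite u2 pmulr_lge0 //.
  rewrite lt_neqAle sqr_ge0 andbT eq_sym sqrf_eq0; apply: contra u0 => /norm2_eq0.
  by move/(congr1 trmx)/eqP; rewrite trmxK trmx0.
have F1 : `|(flow S t *m e_first R k.+1) ord_max 0| <=
    `|subdiag_prod S k| * t ^+ k.+1 / (k.+1)`!%:R.
  have := @flow_last_entry_bound _ _ S s 1 t hessS (monic1 _).
  rewrite rmorph1 -[1 *m _]/(1%:M *m flow S t) mul1mx mul1r ss size_poly1.
  apply=> //.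
  by move=> a /sS/Spos.
rewrite normrM in hpi.
apply: (@le_trans _ _ (c ^+ k.+1 / 2 ^+ k * (t ^+ k.+1 / (k.+1)`!%:R))).
  apply: le_trans (ler_wpM2l (normr_ge0 h) F1) _.
  by rewrite !mulrA ler_wpM2r ?invr_ge0 // ler_wpM2r ?exprn_ge0.
have E : c ^+ k.+1 / 2 ^+ k * (t ^+ k.+1 / (k.+1)`!%:R) =
    2 * (c * t) ^+ k.+1 / (2 ^ k.+1 * (k.+1)`!)%:R.
  rewrite natrM natrX exprMn (exprS 2).
  have : (k.+1)`!%:R != 0 :> R by rewrite pnatr_eq0 -lt0n fact_gt0.
  have : 2 ^+ k != 0 :> R by rewrite expf_neq0 // pnatr_eq0.
  move: (c ^+ _) (t ^+ _) (2 ^+ k) (_`!%:R) => x y z w z0 w0.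
  by field; rewrite ?z0 ?w0.
rewrite E.
apply: (@le_trans _ _ (16 * (c * t) ^+ k.+1 / (2 ^ k.+1 * (k.+1)`!)%:R)).
  rewrite ler_wpM2r ?invr_ge0 // ler_wpM2r ?ler_nat //.
  by rewrite exprn_ge0 // mulr_ge0 // ltW.
rewrite ler_wpM2l //; first by rewrite mulr_ge0 // exprn_ge0 // mulr_ge0 // ltW.
rewrite lef_pV2 ?posrE ?ltr0n ?odd_dfact_gt0 ?muln_gt0 ?expn_gt0 ?fact_gt0 //.
by rewrite ler_nat odd_dfact_le.
Qed.
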